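(* Let $k\ge 1$ and let $A[1..n]$ be an array of distinct numbers. The solutions to all queries $\textsc{RTopK}(A[i..j])$, $1\le i\le j\le n$, can be encoded in at most $(k+1)nH(\frac{1}{k+1})$ bits of space; that is, there is a bit string of at most this length, computed from $A$, from which the answer to every such query can be determined.
   Context: $\textsc{RTopK}(A[i..j])$ returns the ordered list of indices $\ell_1,\ell_2,\dots$ of the $k$ largest elements of $A[i..j]$ (all of them if $j-i+1<k$), where $A[\ell_m]$ is the $m$-th largest element in $A[i..j]$. $H(x)=x\lg\frac{1}{x}+(1-x)\lg\frac{1}{1-x}$ is the binary entropy function, $\lg=\log_2$. *)

(* Defs.v *)
From HB Require Import structures.
From mathcomp Require Import all_boot all_order all_algebra.
From mathcomp Require Import reals exp.

Set Implicit Arguments.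
Unset Strict Implicit.
Unset Printing Implicit Defensive.

Import Order.TTheory GRing.Theory Num.Theory.
Local Open Scope ring_scope.

Definition lg (R : realType) (x : R) : R := ln x / ln 2.

Definition binary_entropy (R : realType) (x : R) : R :=
  x * lg (1 / x) + (1 - x) * lg (1 / (1 - x)).

(* Positions are 0-based: the ordinal l : 'I_n is position l + 1 of A[1..n].
   [take] returns the whole list when the range has fewer than k positions. *)
Definition rtopk (R : realType) (k n : nat) (A : {ffun 'I_n -> R})
    (i j : 'I_n) : seq 'I_n :=
  take k (sort (fun x y : 'I_n => A y <= A x)
               [seq l : 'I_n <- enum 'I_n | (i <= l <= j)%N]).

(* Main.v *)
(** Scan [A] from left to right.  Call position [i] alive at time [j] if fewer
    than [k] entries strictly between [i] and [j] exceed [A i].  Only alive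
    positions can occur in the answer to a query ending just before [j], so it
    suffices to know the relative order of the alive positions at every time.
    That order is recovered step by step from the numbers [c_j] of alive
    positions whose entry is below [A j], as [c_j] is the rank at which [j] has
    to be inserted.  Every position is overtaken at most [k] times while alive,
    hence [c_0 + ... + c_(n-1) <= k n].  Giving each tuple [c] the weight
    [x ^ (c_0 + ... + c_(n-1))] with [x = k / (k+1)], whose total over all
    tuples is at most [(k+1) ^ n], shows that there are at most
    [(k+1) ^ ((k+1) n) / k ^ (k n)] admissible tuples, and the logarithm of this
    bound is [(k+1) n H(1/(k+1))].  Numbering the admissible tuples from 1 and
    writing the number in binary without its leading 1 loses nothing to
    rounding. *)

Require Import Defs.
From HB Require Import structures.
From mathcomp Require Import all_boot all_order all_algebra.
From mathcomp Require Import boolp reals exp.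
From mathcomp Require Import zify ring lra.
Import Order.TTheory GRing.Theory Num.Theory.
Local Open Scope ring_scope.

(** * Truncated and sorted lists *)

Lemma take_filter_all (T : Type) (k : nat) (p : pred T) (s : seq T) :
  all p (take k s) -> take k (filter p s) = take k s.
Proof.
move=> /all_filterP pk; rewrite -{1}(cat_take_drop k s) filter_cat pk.
have [le_sk|lt_ks] := leqP (size s) k.
  by rewrite drop_oversize // cats0 take_oversize // size_take; case: ltnP.
by rewrite take_size_cat // size_takel // ltnW.
Qed.

Lemma sort_congr_in (T : eqType) (r1 r2 : rel T) (s : seq T) :
  total r1 -> transitive r1 -> antisymmetric r1 -> total r2 ->
  {in s &, r1 =2 r2} -> sort r1 s = sort r2 s.
Proof.
move=> tot1 tr1 as1 tot2 r12; apply: (sorted_eq tr1 as1).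
- exact: sort_sorted.
- rewrite (eq_in_sorted r12) ?sort_sorted //.
  by apply/allP => x; rewrite mem_sort.
- by rewrite perm_sort perm_sym perm_sort.
Qed.

(** * Alive positions and their relative order *)

Section Alive.

Context {d : Order.disp_t} {T : orderType d} (k : nat) {n : nat}.
Implicit Types (A B : 'I_n -> T) (i l : 'I_n) (j : nat).

Definition overtakers A j i : {set 'I_n} :=
  [set l : 'I_n | (i < l < j)%N && (A i < A l)%O].

Definition alive A j i : bool := (i < j)%N && (#|overtakers A j i| < k)%N.

Definition overtaken A i : {set 'I_n} :=
  [set l : 'I_n | alive A i l && (A l < A i)%O].

(** The finite codomain lets codes be enumerated and counted; counts are at most [n], so [inord]
    never truncates. *)
Definition overtaken_code A : {ffun 'I_n -> 'I_n.+1} :=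
  [ffun i => inord #|overtaken A i|].

Lemma overtaken_codeE A i : overtaken_code A i = #|overtaken A i| :> nat.
Proof.
by rewrite ffunE inordK // ltnS (leq_trans (max_card _)) // card_ord.
Qed.

(** The last [m] in this set overtakes [i] while [i] is alive, and all its other elements are
    overtakers of [i] before [m], so there are fewer than [k] of them. *)
Lemma card_overtaken_at_most A i :
  (#|[set l | i \in overtaken A l]| <= k)%N.
Proof.
set D := [set _ | _]; have [->|[l0 l0D]] := set_0Vmem D; first by rewrite cards0.
have [m mD maxm] := arg_maxnP (fun l : 'I_n => val l) l0D.
have {}mD : m \in D by [].
have /andP[/andP[im ltk] _] : alive A m i && (A i < A m)%O.
  by move: mD; rewrite !inE.
rewrite (cardsD1 m) mD add1n; apply: leq_ltn_trans ltk.
apply/subset_leq_card/subsetP => l; rewrite 2!inE => /andP[lm lD].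
have := maxm _ lD; move: lD; rewrite !inE => /andP[/andP[il _] Ail] /= lem.
by rewrite il Ail andbT /= ltn_neqAle lem andbT.
Qed.

Lemma sum_overtaken_code A : (\sum_i overtaken_code A i <= k * n)%N.
Proof.
under eq_bigr => i _ do rewrite overtaken_codeE -sum1_card big_mkcond.
rewrite exchange_big /=.
have -> : (k * n = \sum_(l < n) k)%N by rewrite sum_nat_const card_ord mulnC.
apply: leq_sum => l _; apply: leq_trans (card_overtaken_at_most A l).
rewrite -sum1_card [X in (_ <= X)%N]big_mkcond /=.
by apply: leq_sum => i _; rewrite [i \in _]inE.
Qed.

Lemma overtakersS A i (m : 'I_n) : (i < m)%N ->
  #|overtakers A m.+1 i| = (#|overtakers A m i| + (A i < A m)%O)%N.
Proof.
move=> im; rewrite (cardsD1 m) !inE im ltnSn addnC; congr (_ + _)%N.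
apply: eq_card => l; rewrite !inE -val_eqE /=; have [->|nlm] := eqVneq (val l) m.
  by rewrite ltnn andbF.
by rewrite ltnS [(l <= m)%N]leq_eqVlt (negbTE nlm).
Qed.

Lemma overtakersSn A (m : 'I_n) : overtakers A m.+1 m = set0.
Proof.
apply/setP => l; rewrite !inE; apply/negbTE.
by rewrite ltnS; case: ltngtP.
Qed.

(** The invariant of the scan. Counts are cut off at [k] because the code says nothing about a
    position once it is dead. *)
Definition agree_below A B j : Prop :=
  (forall i, (i < j)%N ->
     minn k #|overtakers A j i| = minn k #|overtakers B j i|) /\
  (forall i l, alive A j i -> alive A j l -> (A i < A l)%O = (B i < B l)%O).

Lemma agree_alive A B j i : agree_below A B j -> alive A j i = alive B j i.
Proof.
case=> [h _]; rewrite /alive; case: ltnP => //= /h.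
by move: #|_| #|_| => a b; lia.
Qed.

(* Both sets of overtaken positions are down-sets of the same chain, so they are
   nested, and equal as soon as their cardinals are. *)
Lemma agree_overtaken A B (m : 'I_n) : agree_below A B m ->
  #|overtaken A m| = #|overtaken B m| -> overtaken A m = overtaken B m.
Proof.
move=> ag ceq; have [_ ord] := ag.
have [AB|/subsetPn[x xA xB]] := boolP (overtaken A m \subset overtaken B m).
  by apply/eqP; rewrite eqEcard AB ceq leqnn.
apply/esym/eqP; rewrite eqEcard ceq leqnn andbT; apply/subsetP => y.
move: xA xB; rewrite !inE -!(agree_alive _ _ _ _ ag).
case/andP => ax xA; rewrite ax /= -leNgt => xB /andP[ay yB].
rewrite ay (lt_trans _ xA) // (ord _ _ ay ax).
exact: lt_le_trans yB xB.
Qed.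

Lemma alive_pred A (m i : 'I_n) : (i < m)%N -> alive A m.+1 i -> alive A m i.
Proof.
move=> im; rewrite /alive im overtakersS //= => /andP[_].
exact/leq_ltn_trans/leq_addr.
Qed.

Lemma agree_below_code A B j : injective A -> injective B ->
  overtaken_code A = overtaken_code B -> (j <= n)%N -> agree_below A B j.
Proof.
move=> injA injB eqc; elim: j => [|j IH] jn.
  by split => // i l; rewrite /alive ltn0.
have ag := IH (ltnW jn); have [cnt ord] := ag.
pose m := Ordinal jn; rewrite -[j]/(val m) in ag cnt ord *.
have eqm : overtaken A m = overtaken B m.
  by apply: agree_overtaken ag _; rewrite -!overtaken_codeE eqc.
have below i : alive A m i -> (A i < A m)%O = (B i < B m)%O.
  move=> ai; have := congr1 (fun X : {set 'I_n} => i \in X) eqm.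
  by rewrite !inE -(agree_alive _ _ _ _ ag) ai.
have above i : alive A m i -> (A m < A i)%O = (B m < B i)%O.
  move=> ai; have nim : i != m by apply: contraTneq ai => ->; rewrite /alive ltnn.
  by rewrite !lt_def !leNgt below // !(inj_eq injA, inj_eq injB).
split=> [i|i l].
  rewrite ltnS leq_eqVlt => /orP[/eqP/val_inj ->|im]; first by rewrite !overtakersSn.
  rewrite !overtakersS //; have := cnt i im.
  have [ai|] := boolP (alive A m i).
    by rewrite below //; move: #|_| #|_| (nat_of_bool _) => a b c; lia.
  (* A dead [i] has at least [k] overtakers in both arrays, so both truncated counts stay at [k]. *)
  rewrite /alive im /=; move: #|_| #|_| (nat_of_bool _) (nat_of_bool _).
  by move=> a b c c'; lia.
move=> ai al.
have [im lm] : (i <= m)%N /\ (l <= m)%N by move: ai al => /andP[+ _] /andP[+ _].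
move: im lm; rewrite leq_eqVlt [(l <= m)%N]leq_eqVlt.
move=> /orP[/eqP/val_inj im|im] /orP[/eqP/val_inj lm|lm].
- by rewrite im lm !ltxx.
- by rewrite im above //; apply: alive_pred al.
- by rewrite lm below //; apply: alive_pred ai.
- by apply: ord; apply: alive_pred.
Qed.

End Alive.

(** * Recovering the answers from the code *)

Section RangeTopK.

Context {R : realType} (k : nat) {n : nat}.
Implicit Types A B : {ffun 'I_n -> R}.

Lemma total_decreasing A : total (fun x y : 'I_n => A y <= A x).
Proof. by move=> x y; apply: le_total. Qed.

Lemma transitive_decreasing A : transitive (fun x y : 'I_n => A y <= A x).
Proof. by move=> x y z xy zx; apply: le_trans zx xy. Qed.

Lemma antisymmetric_decreasing A :
  injective A -> antisymmetric (fun x y : 'I_n => A y <= A x).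
Proof. by move=> injA x y h; apply/injA/le_anti; rewrite andbC. Qed.

(** Every overtaker of [l] up to [j] lies in the range and precedes [l] in decreasing order, so
    there are at most [index l t] of them. *)
Lemma rtopk_alive A (i j : 'I_n) : all (alive k A j.+1) (rtopk k A i j).
Proof.
rewrite /rtopk; set s := filter _ _; set t := sort _ s.
have t_uniq : uniq t by rewrite sort_uniq filter_uniq // enum_uniq.
have mem_t l : (l \in t) = (i <= l <= j)%N.
  by rewrite mem_sort mem_filter mem_enum andbT.
have t_sorted : sorted (fun x y : 'I_n => A y <= A x) t.
  exact: sort_sorted (total_decreasing A) _.
apply/allP => l lk; have lt := mem_take lk.
have /andP[il lj] : (i <= l <= j)%N by rewrite -mem_t.
have idx : (index l t < k)%N by move: lk; rewrite in_take.
rewrite /alive ltnS lj /=; apply: leq_ltn_trans idx.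
rewrite -[X in (_ <= X)%N](@size_takel _ _ t) ?index_size //.
apply: leq_trans (card_size _); apply/subset_leq_card/subsetP => l'.
rewrite inE ltnS => /andP[/andP[ll' l'j] All'].
have l't : l' \in t by rewrite mem_t l'j andbT (leq_trans il (ltnW ll')).
rewrite in_take // ltnNge; apply/negP => le_idx.
have := sorted_leq_index (transitive_decreasing A) (fun x => lexx (A x))
  t_sorted l l' lt l't le_idx.
by rewrite leNgt All'.
Qed.

Lemma rtopk_filter_alive A (i j : 'I_n) : rtopk k A i j =
  take k (sort (fun x y : 'I_n => A y <= A x)
    [seq l <- [seq l : 'I_n <- enum 'I_n | (i <= l <= j)%N] | alive k A j.+1 l]).
Proof.
rewrite -filter_sort; last exact: transitive_decreasing.
  by rewrite take_filter_all // rtopk_alive.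
exact: total_decreasing.
Qed.

Lemma rtopk_code A B : injective A -> injective B ->
  overtaken_code k A = overtaken_code k B -> rtopk k A =2 rtopk k B.
Proof.
move=> injA injB eqc i j.
have ag : agree_below k A B j.+1 by apply: agree_below_code.
rewrite !rtopk_filter_alive.
under [X in _ = take k (sort _ X)]eq_filter => l do
  rewrite -(agree_alive _ _ _ _ _ ag).
congr take; apply: sort_congr_in.
- exact: total_decreasing.
- exact: transitive_decreasing.
- exact: antisymmetric_decreasing.
- exact: total_decreasing.
move=> x y; rewrite !mem_filter => /andP[ax _] /andP[ay _].
by have [_ ord] := ag; rewrite !leNgt ord.
Qed.

End RangeTopK.

(** * Bit strings and the counting bound *)

(* The number whose binary digits are those of [s], least significant first,
   followed by an extra leading 1. *)
Definition bits_value (s : seq bool) : nat :=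
  foldr (fun (b : bool) v => (b + v.*2)%N) 1%N s.

Lemma exp2_size_bits_value s : (2 ^ size s <= bits_value s)%N.
Proof.
elim: s => //= b s IH; rewrite expnS mul2n.
by apply: leq_trans (leq_addl _ _); rewrite leq_double.
Qed.

Lemma bits_value_surj (r : nat) : (0 < r)%N -> exists s, bits_value s == r.
Proof.
elim/ltn_ind: r => -[//|[_ _|r IH _]]; first by exists [::].
have [||s /eqP vs] := IH (r.+2)./2; [by lia|by lia|].
by exists (odd r.+2 :: s); rewrite -[X in _ == X]odd_double_half -vs.
Qed.

Lemma card_bounded_sum_codes (R : realFieldType) (k n m : nat) : (0 < k)%N ->
  #|[set c : {ffun 'I_n -> 'I_m} | (\sum_i c i <= k * n)%N]|%:R * k%:R ^+ (k * n)
    <= k.+1%:R ^+ (k.+1 * n) :> R.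
Proof.
move=> k0; set S := [set _ | _].
have k1 : 0 < k.+1%:R :> R by rewrite ltr0n.
pose x : R := k%:R / k.+1%:R.
have x0 : 0 <= x by rewrite divr_ge0.
have x1 : x <= 1 by rewrite ler_pdivrMr // mul1r ler_nat.
(* As [1 - x] is [1 / (k + 1)], the geometric sum is at most [k + 1] for every [m]. *)
have geo : \sum_(i < m) x ^+ i <= k.+1%:R.
  have := subrX1 x m; have -> : x - 1 = - k.+1%:R^-1.
    by rewrite /x -natr1; field; rewrite natr1 gt_eqF.
  move=> e; have -> : \sum_(i < m) x ^+ i = k.+1%:R * (1 - x ^+ m).
    by rewrite -opprB e mulNr opprK mulVKf // gt_eqF.
  by rewrite ler_piMr // gerBl exprn_ge0.
have wt : #|S|%:R * x ^+ (k * n) <= k.+1%:R ^+ n.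
  (* Since [x <= 1], each admissible tuple weighs at least [x ^ (k * n)]; the total weight factors
     into [n] geometric sums. *)
  apply: (@le_trans _ _ (\sum_(c : {ffun 'I_n -> 'I_m}) \prod_i x ^+ c i)).
    rewrite mulr_natl -sumr_const big_mkcond /=; apply: ler_sum => c _.
    rewrite -expr_sum; case: ifP => [|_]; last exact: exprn_ge0.
    by rewrite inE; apply: ler_wiXn2l.
  rewrite -(bigA_distr_bigA (fun _ (i : 'I_m) => x ^+ i)) prodr_const card_ord.
  by apply: lerXn2r => //; rewrite nnegrE ?sumr_ge0 // => i _; apply: exprn_ge0.
by move: wt; rewrite expr_div_n mulrA ler_pdivrMr ?exprn_gt0 // -exprD -mulSn.
Qed.

Lemma entropy_inv_succ (R : realType) (k : nat) : (0 < k)%N ->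
  (k + 1)%:R * binary_entropy (1 / (k + 1)%:R : R) * ln 2
    = k.+1%:R * ln k.+1%:R - k%:R * ln k%:R.
Proof.
move=> k0; rewrite addn1 /binary_entropy /lg.
have kp : 0 < k%:R :> R by rewrite ltr0n.
have k1 : 0 < k.+1%:R :> R by rewrite ltr0n.
have l2 : ln 2 != 0 :> R by rewrite gt_eqF // ln_gt0 // ltr1n.
have -> : 1 - 1 / k.+1%:R = k%:R / k.+1%:R :> R.
  by rewrite -natr1; field; rewrite natr1 gt_eqF.
rewrite !div1r invrK invf_div lnM ?lnV ?posrE ?invr_gt0 //.
by rewrite -natr1 in k1 *; field; rewrite l2 gt_eqF.
Qed.

Lemma size_bits_entropy (R : realType) (k n m : nat) (s : seq bool) : (0 < k)%N ->
  (bits_value s <= #|[set c : {ffun 'I_n -> 'I_m} | (\sum_i c i <= k * n)%N]|)%N ->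
  (size s)%:R <= (k + 1)%:R * n%:R * binary_entropy (1 / (k + 1)%:R : R).
Proof.
move=> k0 les; have l2 : 0 < ln 2 :> R by rewrite ln_gt0 // ltr1n.
have kp : 0 < k%:R :> R by rewrite ltr0n.
have k1 : 0 < k.+1%:R :> R by rewrite ltr0n.
have le2 : 2 ^+ size s * k%:R ^+ (k * n) <= k.+1%:R ^+ (k.+1 * n) :> R.
  apply: le_trans (card_bounded_sum_codes R k n m k0).
  rewrite ler_pM2r ?exprn_gt0 // -natrX ler_nat.
  exact: leq_trans (exp2_size_bits_value s) les.
move: le2; rewrite -ler_ln ?posrE ?mulr_gt0 ?exprn_gt0 //.
rewrite lnM ?posrE ?exprn_gt0 // !lnXn //.
rewrite -!(mulr_natr (ln _)) !natrM => le2; rewrite -(ler_pM2r l2).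
have -> : (k + 1)%:R * n%:R * binary_entropy (1 / (k + 1)%:R : R) * ln 2
    = n%:R * (k.+1%:R * ln k.+1%:R - k%:R * ln k%:R).
  by rewrite -entropy_inv_succ //; ring.
lra.
Qed.

Theorem theorem3 (R : realType) (k n : nat) (hk : (1 <= k)%N) :
  exists (enc : {ffun 'I_n -> R} -> seq bool)
         (dec : seq bool -> 'I_n -> 'I_n -> seq 'I_n),
    forall A : {ffun 'I_n -> R}, injective A ->
      (size (enc A))%:R
        <= (k + 1)%:R * n%:R * binary_entropy (1 / (k + 1)%:R : R)
      /\ forall i j : 'I_n, (i <= j)%N -> dec (enc A) i j = rtopk k A i j.
Proof.
pose S := [set c : {ffun 'I_n -> 'I_n.+1} | (\sum_i c i <= k * n)%N].
pose code (A : {ffun 'I_n -> R}) := overtaken_code k A.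
have codeS A : code A \in S by rewrite inE sum_overtaken_code.
(* Indices are shifted by one because [bits_value] is always positive; the result is still at most
   [#|S|]. *)
pose enc A := xchoose (bits_value_surj (index (code A) (enum S)).+1 isT).
have encE A : bits_value (enc A) = (index (code A) (enum S)).+1.
  exact/eqP/(xchooseP (bits_value_surj _ _)).
(* Any distinct-entry array encoded by [s] will do, as all of them share one code and hence all
   answers. *)
pose dec s :=
  if pselect (exists A : {ffun 'I_n -> R}, injective A /\ enc A = s) is left ex
  then rtopk k (sval (cid ex)) else fun _ _ => [::].
exists enc, dec => A injA; split.
  apply: (@size_bits_entropy R k n n.+1) => //.
  by rewrite encE cardE index_mem mem_enum.
move=> i j _; rewrite /dec; case: pselect => [ex|[]]; last by exists A.
case: (cid ex) => B [injB encB] /=; apply: rtopk_code => //.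
apply: (@index_inj _ (code A) (enum S)); rewrite ?mem_enum ?codeS //.
by apply/eqP; rewrite -eqSS -!encE encB.
Qed.
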